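(* Let $M\in\mathbb{R}^{m\times m}$ be nonsymmetric and positive definite, let $A\in\mathbb{R}^{m\times n}$ have full column rank, and let $b\in\mathbb{R}^n$, $b\neq0$. Suppose that the nonsymmetric generalized Golub-Kahan process started from $b$ (described in the context) runs for $k\geq 1$ steps, and let $u_k=V_kz_k$ with $z_k=\beta_1L_k^{-T}B_k^{-T}e_1$ be the $k$-th approximate solution, where $e_1$ is the first standard basis vector of $\mathbb{R}^k$. Then the residual norm at step $k$ is $$\|b-A^Tu_k\|_2=\beta_{k+1}\,|\chi_k|,$$ where $$\chi_1=\frac{\beta_1}{\alpha_1},\qquad \chi_j=-\frac{\beta_j}{\alpha_j}\,\chi_{j-1}\quad(2\le j\le k).$$
   Context: Positive definite means $x^TMx>0$ for all nonzero $x\in\mathbb{R}^m$ (no symmetry required). Write $\|x\|_M=\sqrt{x^TMx}$ and $\|\cdot\|_2$ for the Euclidean norm. Exact arithmetic is assumed. $X^{-T}$ denotes $(X^{-1})^T$. Nonsymmetric generalized Golub-Kahan process started from $b$: set $\beta_1=\|b\|_2$, $q_1=b/\beta_1$, $w_1=M^{-1}Aq_1$, $\alpha_1=\|w_1\|_M$, $v_1=w_1/\alpha_1$. For $j=2,3,\dots$: with $Q_{j-1}=[q_1,\dots,q_{j-1}]$, set $h_j=Q_{j-1}^TA^Tv_{j-1}=(\theta_{1,j},\dots,\theta_{j-1,j})^T$, $g_j=A^Tv_{j-1}-Q_{j-1}h_j$, $\beta_j=\|g_j\|_2$; if $\beta_j=0$ the process stops; otherwise $q_j=g_j/\beta_j$,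 $w_j=M^{-1}(Aq_j-\beta_jMv_{j-1})$, $\alpha_j=\|w_j\|_M$, $v_j=w_j/\alpha_j$. ''The process runs for $k$ steps'' means that $\beta_1,\dots,\beta_k$ are all nonzero, so that $q_1,\dots,q_k$ and $v_1,\dots,v_k$ are defined; then $\beta_{k+1}=\|g_{k+1}\|_2$ is also defined (possibly zero). Matrices: $Q_k=[q_1,\dots,q_k]\in\mathbb{R}^{n\times k}$, $V_k=[v_1,\dots,v_k]\in\mathbb{R}^{m\times k}$, $L_k=V_k^TMV_k\in\mathbb{R}^{k\times k}$. $B_k\in\mathbb{R}^{k\times k}$ is the upper bidiagonal matrix with diagonal $\alpha_1,\dots,\alpha_k$ and superdiagonal $\beta_2,\dots,\beta_k$ (that is, $(B_k)_{j-1,j}=\beta_j$). The matrices $B_k$ and $L_k$ are invertible. The vector $u_k$ approximates the component $u$ of the solution of $Mu+Ap=0$, $A^Tu=b$. *)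

(* Defs.v *)
From mathcomp Require Export all_boot all_order all_algebra.
From mathcomp Require Export reals.

Set Implicit Arguments.
Unset Strict Implicit.
Unset Printing Implicit Defensive.

Import Order.TTheory GRing.Theory Num.Theory.
Local Open Scope ring_scope.

(* No symmetry of M is assumed: "nonsymmetric" means "not necessarily
   symmetric". *)
Definition posdefmx (R : realType) (m : nat) (M : 'M[R]_m) : Prop :=
  forall x : 'cV[R]_m, x != 0 -> 0 < (x^T *m M *m x) 0 0.

Definition mxnorm (R : realType) (m : nat) (M : 'M[R]_m) (x : 'cV[R]_m) : R :=
  Num.sqrt ((x^T *m M *m x) 0 0).

Definition norm2 (R : realType) (n : nat) (x : 'cV[R]_n) : R :=
  Num.sqrt (\sum_(i < n) x i 0 ^+ 2).

Definition cols_mx (R : realType) (n : nat) (s : seq 'cV[R]_n) :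
    'M[R]_(n, size s) :=
  \matrix_(i < n, l < size s) (nth 0 s l) i 0.

(* State after step j: st_qs = [:: q_1; ...; q_j], and beta_j, alpha_j, v_j. *)
Record ggk_state (R : realType) (m n : nat) := GGKState {
  st_qs : seq 'cV[R]_n;
  st_beta : R;
  st_alpha : R;
  st_v : 'cV[R]_m }.

Section GolubKahan.
Variables (R : realType) (m n : nat).
Variables (M : 'M[R]_m) (A : 'M[R]_(m, n)) (b : 'cV[R]_n).

Definition ggk_first : ggk_state R m n :=
  let beta := norm2 b in
  let q := beta^-1 *: b in
  let w := invmx M *m (A *m q) in
  let alpha := mxnorm M w in
  GGKState [:: q] beta alpha (alpha^-1 *: w).

(* Total, since 0^-1 = 0: once some beta_j = 0 the process has stopped, and the
   values of q_j, alpha_j, v_j and of all later steps are meaningless.  The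
   number beta_j itself is meaningful as soon as the first j - 1 steps are. *)
Definition ggk_next (s : ggk_state R m n) : ggk_state R m n :=
  let Q := cols_mx (st_qs s) in
  let h := Q^T *m (A^T *m st_v s) in
  let g := A^T *m st_v s - Q *m h in
  let beta := norm2 g in
  let q := beta^-1 *: g in
  let w := invmx M *m (A *m q - beta *: (M *m st_v s)) in
  let alpha := mxnorm M w in
  GGKState (rcons (st_qs s) q) beta alpha (alpha^-1 *: w).

(* Steps are numbered from 1; index 0 is a junk value, equal to index 1. *)
Definition ggk (j : nat) : ggk_state R m n := iter j.-1 ggk_next ggk_first.

Definition ggk_beta (j : nat) : R := st_beta (ggk j).
Definition ggk_alpha (j : nat) : R := st_alpha (ggk j).
Definition ggk_v (j : nat) : 'cV[R]_m := st_v (ggk j).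

Definition ggk_runs (k : nat) : Prop :=
  forall j : nat, (1 <= j <= k)%N -> ggk_beta j != 0.

(* Row and column indices of matrices start at 0, hence the shifts by one. *)
Definition ggk_V (k : nat) : 'M[R]_(m, k) :=
  \matrix_(i < m, l < k) ggk_v l.+1 i 0.

Definition ggk_L (k : nat) : 'M[R]_k := (ggk_V k)^T *m M *m ggk_V k.

Definition ggk_B (k : nat) : 'M[R]_k :=
  \matrix_(i < k, l < k)
    (if l == i :> nat then ggk_alpha l.+1
     else if l == i.+1 :> nat then ggk_beta l.+1
     else 0).

Definition e1 (k : nat) : 'cV[R]_k := \col_(i < k) (i == 0 :> nat)%:R.

Definition ggk_z (k : nat) : 'cV[R]_k :=
  ggk_beta 1 *: ((invmx (ggk_L k))^T *m (invmx (ggk_B k))^T *m e1 k).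

Definition ggk_u (k : nat) : 'cV[R]_m := ggk_V k *m ggk_z k.

End GolubKahan.

(* Main.v *)
Require Import Defs.
From mathcomp Require Import all_boot all_order all_algebra reals.
Import Order.TTheory GRing.Theory Num.Theory.
Local Open Scope ring_scope.

Set Implicit Arguments.
Unset Strict Implicit.
Unset Printing Implicit Defensive.

(** One step of the process gives two relations:
      [A q_j = alpha_j M v_j + beta_j M v_(j-1)], that is [A Q = M V B], and
      [A^T v_j = sum_(l <= j) theta_l q_l + beta_(j+1) q_(j+1)].
    The vectors [q_j] are orthonormal, so the second relation says
    [A^T V = Q (Q^T A^T V) + g e_k^T] with [g = beta_(k+1) q_(k+1)], and by
    the first one [Q^T A^T V = (V^T A Q)^T = (L B)^T].  Now [z] is defined by
    [(L B)^T z = beta_1 e_1], whence [A^T u_k = beta_1 q_1 + z_k g = b + z_k g]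
    and the residual is [- z_k g], of norm [beta_(k+1) |z_k|].

    To find [z_k], pair [v_i] with both relations.  For [j > i + 1] the number
    [v_i^T A q_j] vanishes, and for [j = i + 1] it is [beta_j]; solving the
    first relation for [M v_j] then shows [v_i^T M v_j = 0] for [i < j]
    ([v_M_upper0]).  So [L] is unit lower triangular, hence invertible, and the
    last entry of [z] is that of [L^T z], the solution of the lower bidiagonal
    system [B^T y = beta_1 e_1].  Forward substitution in this system is the
    recurrence that defines [chi].

    The divisions are legitimate because no [alpha_j] vanishes ([alpha_neq0]):
    each [M v_j] is [A x] with [x] in the span of [q_1, ..., q_j], so
    [alpha_j = 0] would give [A q_j = beta_j A x] with [x] orthogonal to [q_j],
    and [A] is injective. *)

(** * Inner products and norms *)

Definition dot (R : realType) (n : nat) (x y : 'cV[R]_n) : R := (x^T *m y) 0 0.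

Section Dot.
Variables (R : realType) (n : nat).
Implicit Types x y z : 'cV[R]_n.

Lemma dotC x y : dot x y = dot y x.
Proof. by rewrite /dot !mxE; apply: eq_bigr => i _; rewrite !mxE mulrC. Qed.

Lemma dotDr x y z : dot x (y + z) = dot x y + dot x z.
Proof. by rewrite /dot mulmxDr mxE. Qed.

Lemma dotBr x y z : dot x (y - z) = dot x y - dot x z.
Proof. by rewrite /dot mulmxBr !mxE. Qed.

Lemma dotZr a x y : dot x (a *: y) = a * dot x y.
Proof. by rewrite /dot -scalemxAr mxE. Qed.

Lemma dotZl a x y : dot (a *: x) y = a * dot x y.
Proof. by rewrite dotC dotZr dotC. Qed.

Lemma dot0r x : dot x 0 = 0.
Proof. by rewrite /dot mulmx0 mxE. Qed.

Lemma dot_sumr x (I : Type) (r : seq I) (F : I -> 'cV[R]_n) :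
  dot x (\sum_(i <- r) F i) = \sum_(i <- r) dot x (F i).
Proof. by rewrite /dot mulmx_sumr summxE. Qed.

Lemma norm2E x : norm2 x = Num.sqrt (dot x x).
Proof.
by rewrite /norm2 /dot mxE; congr Num.sqrt; apply: eq_bigr => i _; rewrite mxE.
Qed.

Lemma dotxx_ge0 x : 0 <= dot x x.
Proof. by rewrite /dot mxE sumr_ge0 // => i _; rewrite mxE -expr2 sqr_ge0. Qed.

Lemma norm2_eq0 x : norm2 x = 0 -> x = 0.
Proof.
rewrite norm2E => /eqP; rewrite sqrtr_eq0 => dx_le0.
have /eqP : dot x x = 0 by apply/le_anti; rewrite dx_le0 dotxx_ge0.
rewrite /dot mxE psumr_eq0 => [/allP x0|i _]; last by rewrite mxE -expr2 sqr_ge0.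
apply/matrixP => i j; rewrite ord1 [RHS]mxE.
by have := x0 i (mem_index_enum i); rewrite mxE -expr2 sqrf_eq0 => /eqP.
Qed.

Lemma norm2Z a x : norm2 (a *: x) = `|a| * norm2 x.
Proof.
by rewrite !norm2E dotZl dotZr mulrA -expr2 sqrtrM ?sqr_ge0 // sqrtr_sqr.
Qed.

Lemma norm2K x : norm2 x *: ((norm2 x)^-1 *: x) = x.
Proof.
have [/norm2_eq0-> | nx0] := eqVneq (norm2 x) 0; first by rewrite !scaler0.
by rewrite scalerA mulfV // scale1r.
Qed.

Lemma dot_normalize x : norm2 x != 0 ->
  dot ((norm2 x)^-1 *: x) ((norm2 x)^-1 *: x) = 1.
Proof.
move=> nx0; rewrite dotZl dotZr mulrA -expr2 exprVn.
have -> : dot x x = norm2 x ^+ 2 by rewrite norm2E sqr_sqrtr ?dotxx_ge0.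
by rewrite mulVf // expf_neq0.
Qed.

Lemma cols_mx_proj (s : seq 'cV[R]_n) x :
  cols_mx s *m ((cols_mx s)^T *m x) = \sum_(q <- s) dot q x *: q.
Proof.
rewrite (big_nth 0) big_mkord; apply/matrixP => i j; rewrite ord1 mxE summxE.
apply: eq_bigr => l _; rewrite !mxE mulrC; congr (_ * _).
by rewrite /dot mxE; apply: eq_bigr => a _; rewrite !mxE.
Qed.

End Dot.

Lemma dot_trmx (R : realType) (m n : nat) (A : 'M[R]_(m, n)) v q :
  dot q (A^T *m v) = dot v (A *m q).
Proof. by rewrite dotC /dot trmx_mul trmxK mulmxA. Qed.

Lemma full_col_rank_inj (R : realType) (m n : nat) (A : 'M[R]_(m, n)) x :
  \rank A = n -> A *m x = 0 :> 'cV_m -> x = 0.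
Proof.
move=> rA Ax0; apply: trmx_inj; rewrite trmx0; apply/eqP.
have Afree : row_free A^T by rewrite /row_free mxrank_tr rA.
by rewrite -(mulmx_free_eq0 _ Afree) -trmx_mul Ax0 trmx0.
Qed.

Section PosDef.
Variables (R : realType) (m : nat) (M : 'M[R]_m).
Hypothesis hM : posdefmx M.

Lemma posdefmx_unit : M \in unitmx.
Proof.
rewrite unitmxE unitfE; apply/negP => /det0P[u u0 uM0].
have : u^T != 0 by rewrite -(inj_eq trmx_inj) trmxK trmx0.
by move=> /hM; rewrite trmxK uM0 mul0mx mxE ltxx.
Qed.

Lemma mxnorm_eq0 w : mxnorm M w = 0 -> w = 0.
Proof.
move=> nw0; apply/eqP; apply: contraT => /hM.
by rewrite -sqrtr_gt0 -/(mxnorm M w) nw0 ltxx.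
Qed.

Lemma mxnormK w : mxnorm M w *: ((mxnorm M w)^-1 *: w) = w.
Proof.
have [/mxnorm_eq0-> | nw0] := eqVneq (mxnorm M w) 0; first by rewrite !scaler0.
by rewrite scalerA mulfV // scale1r.
Qed.

Lemma mxnorm_normalize w (v := (mxnorm M w)^-1 *: w) :
  mxnorm M w != 0 -> dot v (M *m v) = 1.
Proof.
move=> nw0; rewrite {}/v -scalemxAr dotZl dotZr mulrA -expr2 exprVn.
have -> : dot w (M *m w) = mxnorm M w ^+ 2.
  rewrite /dot mulmxA sqr_sqrtr //; have [->|/hM/ltW//] := eqVneq w 0.
  by rewrite mulmx0 mxE.
by rewrite mulVf // expf_neq0.
Qed.

End PosDef.

(** * The recurrences of the process *)

(* In this section the numbers and vectors of step [j] have index [j - 1], as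
   the rows and columns of matrices do. *)
Section Process.
Variables (R : realType) (m n k : nat).
Variables (M : 'M[R]_m) (A : 'M[R]_(m, n)) (b : 'cV[R]_n).
Hypotheses (hM : posdefmx M) (hA : \rank A = n).
(* [k.+1] is the number of steps, so that the last index is [k]. *)
Hypothesis hrun : ggk_runs M A b k.+1.

Local Notation al i := (ggk_alpha M A b i.+1).
Local Notation be i := (ggk_beta M A b i.+1).
Local Notation v i := (ggk_v M A b i.+1).

Definition ggk_q (i : nat) : 'cV[R]_n := last 0 (st_qs (ggk M A b i.+1)).
Local Notation q := ggk_q.

Definition ggk_g (i : nat) : 'cV[R]_n :=
  A^T *m v i - \sum_(l < i.+1) dot (q l) (A^T *m v i) *: q l.
Local Notation g := ggk_g.

Lemma st_qsE i : st_qs (ggk M A b i.+1) = mkseq q i.+1.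
Proof.
elim: i => [|i IHi] //.
rewrite [RHS]/mkseq -[X in iota 0 X]addn1 iotaD map_cat.
rewrite -/(mkseq q i.+1) -IHi /=.
by rewrite cats1 /ggk_q /= last_rcons.
Qed.

Lemma ggk_gE i (Q := cols_mx (st_qs (ggk M A b i.+1))) :
  A^T *m v i - Q *m (Q^T *m (A^T *m v i)) = g i.
Proof.
rewrite /Q cols_mx_proj st_qsE big_map.
by rewrite -[iota _ _]/(index_iota 0 i.+1) big_mkord.
Qed.

Lemma be_succ i : be i.+1 = norm2 (g i).
Proof. by rewrite -ggk_gE. Qed.

Lemma q0E : q 0 = (norm2 b)^-1 *: b.
Proof. by []. Qed.

Lemma q_succ i : q i.+1 = (norm2 (g i))^-1 *: g i.
Proof. by rewrite -ggk_gE {1}/ggk_q /= last_rcons. Qed.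

Lemma q_start : b = be 0 *: q 0.
Proof. by rewrite q0E norm2K. Qed.

(** This relation also holds when [be i.+1] vanishes, since then [g i] does. *)
Lemma q_step i : g i = be i.+1 *: q i.+1.
Proof. by rewrite be_succ q_succ norm2K. Qed.

Lemma At_v i : A^T *m v i =
  \sum_(l < i.+1) dot (q l) (A^T *m v i) *: q l + be i.+1 *: q i.+1.
Proof. by rewrite -q_step /g addrC subrK. Qed.

Lemma v0E : v 0 = (al 0)^-1 *: (invmx M *m (A *m q 0)).
Proof. by []. Qed.

Lemma al0E : al 0 = mxnorm M (invmx M *m (A *m q 0)).
Proof. by []. Qed.

Definition ggk_w i : 'cV[R]_m :=
  invmx M *m (A *m q i.+1 - be i.+1 *: (M *m v i)).

Lemma al_succ i : al i.+1 = mxnorm M (ggk_w i).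
Proof. by rewrite /ggk_w q_succ be_succ -ggk_gE. Qed.

Lemma v_succ i : v i.+1 = (al i.+1)^-1 *: ggk_w i.
Proof. by rewrite al_succ /ggk_w q_succ be_succ -ggk_gE. Qed.

(** A zero [al] is harmless in the next two relations: positive definiteness
    makes the vector that was to be normalized vanish with it. *)
Lemma A_q0 : A *m q 0 = al 0 *: (M *m v 0).
Proof. by rewrite scalemxAr v0E al0E mxnormK // mulKVmx // posdefmx_unit. Qed.

Lemma A_q_succ i :
  A *m q i.+1 = be i.+1 *: (M *m v i) + al i.+1 *: (M *m v i.+1).
Proof.
rewrite [X in _ + X]scalemxAr v_succ al_succ mxnormK // mulKVmx ?posdefmx_unit //.
by rewrite addrC subrK.
Qed.

(** * Orthonormality and nonvanishing of the diagonal *)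

Lemma q_norm i : (i <= k)%N -> dot (q i) (q i) = 1.
Proof.
move=> ik; have : be i != 0 by apply: hrun.
by case: i ik => [|i] ik; rewrite ?be_succ ?q_succ ?q0E => ?; apply: dot_normalize.
Qed.

Lemma q_ortho_lt j i : (i < j <= k)%N -> dot (q i) (q j) = 0.
Proof.
elim/ltn_ind: j i => -[|j] // IHj i /andP[ij jk].
rewrite q_succ dotZr; suff -> : dot (q i) (g j) = 0 by rewrite mulr0.
rewrite /ggk_g dotBr dot_sumr (bigD1 (Ordinal ij)) //= dotZr q_norm; last first.
  by rewrite (leq_trans _ (ltnW jk)) // -ltnS.
rewrite mulr1 big1 ?addr0 ?subrr // => l l_neq_i.
have lk : (l <= k)%N by rewrite (leq_trans _ (ltnW jk)) // -ltnS.
suff qil : dot (q i) (q l) = 0 by rewrite dotZr qil mulr0.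
have [il|li|il] := ltngtP i l.
- by apply: IHj; rewrite // il.
- by rewrite dotC; apply: IHj; rewrite // li (leq_trans _ (ltnW jk)) // -ltnS.
- by move: l_neq_i; rewrite -val_eqE /= il eqxx.
Qed.

Lemma q_ortho i j : (i <= k)%N -> (j <= k)%N -> dot (q i) (q j) = (i == j)%:R.
Proof.
move=> ik jk; case: ltngtP => [ij|ji|->]; last exact: q_norm.
  by rewrite q_ortho_lt // ij.
by rewrite dotC q_ortho_lt // ji.
Qed.

(** [x] lies in the span of [q 0, ..., q i]; the second condition records this
    as orthogonality to the later [q j].  Solving the recurrence for [M *m v i]
    produces [x] step by step. *)
Lemma M_v_image i : (i <= k)%N ->
  exists2 x, M *m v i = A *m x &
    forall j, (i < j <= k)%N -> dot (q j) x = 0.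
Proof.
elim: i => [|i IHi] ik.
  exists ((al 0)^-1 *: q 0) => [|j j0k].
    rewrite v0E -scalemxAr mulKVmx ?posdefmx_unit //.
    exact: scalemxAr.
  by rewrite dotZr dotC q_ortho_lt // mulr0.
have [x Mv x_ortho] := IHi (ltnW ik).
exists ((al i.+1)^-1 *: (q i.+1 - be i.+1 *: x)) => [|j /andP[ij jk]].
  rewrite v_succ -scalemxAr mulKVmx ?posdefmx_unit // Mv.
  by rewrite -!scalemxAr mulmxBr -scalemxAr.
rewrite dotZr dotBr dotZr dotC q_ortho_lt ?ij //.
by rewrite x_ortho ?(ltnW ij) // !mulr0 subr0 mulr0.
Qed.

(** If [al i] vanishes, the recurrence makes [A *m q i] a multiple of the image
    [A *m x] of [M_v_image]; by injectivity [q i] is a multiple of a vector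
    orthogonal to it, which contradicts its unit norm. *)
Lemma alpha_neq0 i : (i <= k)%N -> al i != 0.
Proof.
move=> ik; apply/eqP => al0; have /eqP := q_norm ik.
case: i al0 ik => [|i] al0 ik.
  have -> : q 0 = 0.
    by apply: (@full_col_rank_inj _ _ _ A) => //; rewrite A_q0 al0 scale0r.
  by rewrite dot0r eq_sym oner_eq0.
have [x Mv x_ortho] := M_v_image (ltnW ik).
have /eqP : q i.+1 - be i.+1 *: x = 0.
  apply: (@full_col_rank_inj _ _ _ A) => //; rewrite mulmxBr -scalemxAr -Mv.
  by rewrite A_q_succ al0 scale0r addr0 subrr.
rewrite subr_eq0 => /eqP qE; rewrite {2}qE dotZr x_ortho ?leqnn //.
by rewrite mulr0 eq_sym oner_eq0.
Qed.

(** * The triangular factors *)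

Lemma v_norm i : (i <= k)%N -> dot (v i) (M *m v i) = 1.
Proof.
move=> ik; have := alpha_neq0 ik.
case: i ik => [|i] _; first by rewrite v0E al0E; apply: mxnorm_normalize.
by rewrite v_succ al_succ; apply: mxnorm_normalize.
Qed.

Lemma q_At_v i j : (i < j <= k)%N ->
  dot (q j) (A^T *m v i) = if j == i.+1 then be j else 0.
Proof.
move=> /andP[ij jk]; rewrite At_v dotDr dot_sumr big1 => [|l _].
  rewrite add0r dotZr q_ortho ?(leq_trans ij) //.
  by case: eqP => [->|_]; rewrite ?mulr1 ?mulr0.
rewrite dotZr [dot (q j) _]dotC q_ortho_lt ?mulr0 // jk andbT.
exact: leq_trans (ltn_ord l) ij.
Qed.

(** Pairing [v i] with [A_q_succ] gives [al j * L i j + be j * L i j.-1], where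
    [L i j] is the left-hand side below; by [q_At_v] this is [be j] if
    [j = i.+1], where [L i j.-1 = 1], and zero afterwards. *)
Lemma v_M_upper0 i j : (i < j <= k)%N -> dot (v i) (M *m v j) = 0.
Proof.
elim: j => [|j IHj] // /andP[ij jk].
have := @q_At_v i j.+1; rewrite ij jk dot_trmx A_q_succ dotDr !dotZr => /(_ isT).
apply: contra_eq => Lij; move: ij; rewrite ltnS leq_eqVlt => /orP[/eqP ij|ij].
  rewrite -ij in jk Lij *.
  rewrite eqxx v_norm ?(ltnW jk) // mulr1 -subr_eq0 addrC addKr.
  by rewrite mulf_neq0 // alpha_neq0.
rewrite eqSS gtn_eqF // IHj ?ij ?(ltnW jk) // mulr0 add0r.
by rewrite mulf_neq0 // alpha_neq0.
Qed.

Local Notation V := (ggk_V M A b k.+1).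
Local Notation L := (ggk_L M A b k.+1).
Local Notation B := (ggk_B M A b k.+1).
Local Notation z := (ggk_z M A b k.+1).

Lemma mulmx_matrix_cols (p r s : nat) (X : 'M[R]_(p, r)) (f : nat -> 'cV[R]_r)
    (i : 'I_p) (j : 'I_s) :
  (X *m (\matrix_(a < r, l < s) f l a 0)) i j = (X *m f j) i 0.
Proof. by rewrite !mxE; apply: eq_bigr => a _; rewrite mxE. Qed.

Lemma mulmx_V (p : nat) (X : 'M[R]_(p, m)) i (j : 'I_k.+1) :
  (X *m V) i j = (X *m v j) i 0.
Proof. exact: (mulmx_matrix_cols X (fun l => v l)). Qed.

Lemma ggk_LE (i j : 'I_k.+1) : L i j = dot (v i) (M *m v j).
Proof.
rewrite /ggk_L mulmx_V -mulmxA /dot !mxE.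
by apply: eq_bigr => a _; rewrite !mxE.
Qed.

Lemma ggk_L_upper0 (i j : 'I_k.+1) : (i < j)%N -> L i j = 0.
Proof. by move=> ij; rewrite ggk_LE v_M_upper0 // ij -ltnS ltn_ord. Qed.

Lemma ggk_L_diag (i : 'I_k.+1) : L i i = 1.
Proof. by rewrite ggk_LE v_norm // -ltnS. Qed.

Lemma ggk_L_unit : L \in unitmx.
Proof.
rewrite unitmxE det_trig; last by apply/is_trig_mxP => i j; apply: ggk_L_upper0.
by rewrite big1 ?unitr1 // => i _; apply: ggk_L_diag.
Qed.

Lemma ggk_B_unit : B \in unitmx.
Proof.
rewrite -unitmx_tr unitmxE det_trig.
  rewrite unitfE; apply/prodf_neq0 => i _.
  by rewrite !mxE eqxx alpha_neq0 // -ltnS.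
apply/is_trig_mxP => i j ij.
by rewrite !mxE ltn_eqF // ltn_eqF // (ltn_trans ij).
Qed.

(** A column of [B] has only its diagonal entry and the one above it. *)
Lemma sum_ggk_B (f : nat -> R) (j : 'I_k.+1) :
  \sum_(i < k.+1) f i * B i j =
  f j * al j + (if j == 0 :> nat then 0 else f j.-1 * be j).
Proof.
rewrite (bigD1 j) //= mxE eqxx; congr (_ + _).
case: j => -[|j] jk /=.
  rewrite big1 // => i i_neq; rewrite mxE /= eq_sym.
  by rewrite -val_eqE /= in i_neq; rewrite (negPf i_neq) mulr0.
rewrite (bigD1 (Ordinal (ltnW jk))) -?val_eqE /= ?ltn_eqF // mxE /=.
rewrite eqxx gtn_eqF // big1 ?addr0 // => i /andP[i_neq i_neq'].
rewrite -!val_eqE /= in i_neq i_neq'.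
by rewrite mxE /= eq_sym (negPf i_neq) eqSS eq_sym (negPf i_neq') mulr0.
Qed.

(** * The residual *)

Definition ggk_Q : 'M[R]_(n, k.+1) := \matrix_(i < n, l < k.+1) q l i 0.
Local Notation Q := ggk_Q.

Lemma A_Q : A *m Q = M *m V *m B.
Proof.
apply/matrixP => a j; rewrite (mulmx_matrix_cols _ q) [RHS]mxE.
pose f i := (M *m v i) a 0.
under eq_bigr => i _ do rewrite mulmx_V -/(f i).
rewrite sum_ggk_B /f; case: j => -[|j] jk /=.
  by rewrite A_q0 mxE addr0 mulrC.
by rewrite A_q_succ !mxE addrC mulrC [be _ * _]mulrC.
Qed.

(** The sum over [l <= i] in [At_v] may run over all columns of [Q], because
    the only further inner product that is not zero is [be i.+1]. *)
Lemma At_V : A^T *m V = Q *m (Q^T *m (A^T *m V)) + g k *m delta_mx 0 ord_max.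
Proof.
have proj i l : (Q^T *m (A^T *m V)) l i = dot (q l) (A^T *m v i).
  rewrite mulmxA mulmx_V -mulmxA /dot !mxE.
  by apply: eq_bigr => a _; rewrite !mxE.
apply/matrixP => a i; rewrite mulmx_V [RHS]mxE.
have -> : (Q *m (Q^T *m (A^T *m V))) a i =
    \sum_(l < k.+1) dot (q l) (A^T *m v i) * q l a 0.
  by rewrite mxE; apply: eq_bigr => l _; rewrite proj mxE mulrC.
have -> : (g k *m delta_mx 0 ord_max) a i = g k a 0 * (i == ord_max)%:R.
  by rewrite !mxE big_ord1 !mxE eqxx.
have [-> | i_neq] := eqVneq i ord_max.
  rewrite mulr1 q_step [in LHS]At_v mxE summxE; congr (_ + _).
  by apply: eq_bigr => l _; rewrite mxE.
have ik : (i < k)%N by rewrite ltn_neqAle -ltnS ltn_ord andbT.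
rewrite mulr0 addr0 [in LHS]At_v mxE summxE mxE.
rewrite -(big_mkord predT (fun l => dot (q l) (A^T *m v i) * q l a 0)).
rewrite (@big_cat_nat _ _ _ i.+2) //=.
rewrite [X in _ = _ + X]big_nat [X in _ = _ + X]big1 => [|l /andP[il lk]].
  rewrite addr0 big_nat_recr //= big_mkord q_At_v ?ltnSn // eqxx.
  by congr (_ + _); apply: eq_bigr => l _; rewrite mxE.
by rewrite q_At_v ?gtn_eqF ?mul0r // (ltnW il).
Qed.

Variable chi : nat -> R.
Hypothesis hchi1 : chi 1%N = be 0 / al 0.
Hypothesis hchi : forall j : nat, (2 <= j <= k.+1)%N ->
  chi j = - (ggk_beta M A b j / ggk_alpha M A b j) * chi j.-1.

(** [B^T] is lower bidiagonal, and the recurrence of [chi] is forward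
    substitution in this system. *)
Lemma chi_solves : B^T *m (\col_i chi i.+1) = be 0 *: e1 R k.+1.
Proof.
apply/colP => j; rewrite !mxE.
under eq_bigr => i _ do rewrite mxE [X in _ * X]mxE mulrC.
rewrite (sum_ggk_B (fun i => chi i.+1)); case: j => -[|j] jk /=.
  by rewrite hchi1 addr0 mulr1 divfK // alpha_neq0.
rewrite hchi //= mulrAC mulNr divfK ?alpha_neq0 //.
by rewrite mulr0 mulNr mulrC addNr.
Qed.

Lemma Lt_z : L^T *m z = \col_i chi i.+1.
Proof.
rewrite /ggk_z -scalemxAr !mulmxA -trmx_mul mulVmx ?ggk_L_unit //.
rewrite trmx1 mul1mx scalemxAr -chi_solves trmx_inv mulKmx //.
by rewrite unitmx_tr ggk_B_unit.
Qed.

(** [L^T] is unit upper triangular, so multiplication by it keeps the last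
    entry of a vector. *)
Lemma z_last : z ord_max 0 = chi k.+1.
Proof.
have := congr1 (fun y : 'cV_k.+1 => y ord_max 0) Lt_z.
rewrite mxE [RHS]mxE (bigD1 ord_max) //= mxE ggk_L_diag mul1r big1 ?addr0 // => i i_neq.
rewrite mxE ggk_L_upper0 ?mul0r // ltn_neqAle -ltnS ltn_ord andbT.
exact: i_neq.
Qed.

Lemma residualE : b - A^T *m ggk_u M A b k.+1 = - chi k.+1 *: g k.
Proof.
(* The coefficients in [At_V] are a transposed form of [A_Q]. *)
have QAV : Q^T *m (A^T *m V) = B^T *m L^T.
  by rewrite mulmxA -trmx_mul A_Q /ggk_L !trmx_mul trmxK !mulmxA.
have -> : A^T *m ggk_u M A b k.+1 = b + chi k.+1 *: g k.
  rewrite /ggk_u mulmxA At_V mulmxDl QAV -!mulmxA Lt_z chi_solves -rowE.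
  congr (_ + _); last first.
    by apply/colP => a; rewrite mxE big_ord1 [X in _ * X]mxE z_last [RHS]mxE mulrC.
  rewrite -scalemxAr {2}q_start; congr (_ *: _); apply/colP => a.
  rewrite mxE (bigD1 ord0) //= !mxE eqxx mulr1 big1 ?addr0 // => i i_neq.
  by rewrite -val_eqE /= in i_neq; rewrite !mxE (negPf i_neq) mulr0.
by rewrite opprD addNKr scaleNr.
Qed.

End Process.

Theorem mainTheorem3 (R : realType) (m n k : nat)
  (M : 'M[R]_m) (A : 'M[R]_(m, n)) (b : 'cV[R]_n) (chi : nat -> R)
  (hM : posdefmx M) (hA : \rank A = n) (hb : b != 0)
  (hk : (1 <= k)%N) (hrun : ggk_runs M A b k)
  (hchi1 : chi 1%N = ggk_beta M A b 1 / ggk_alpha M A b 1)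
  (hchi : forall j : nat, (2 <= j <= k)%N ->
     chi j = - (ggk_beta M A b j / ggk_alpha M A b j) * chi j.-1) :
  norm2 (b - A^T *m ggk_u M A b k) = ggk_beta M A b k.+1 * `|chi k|.
Proof.
case: k hk hrun hchi => // k _ hrun hchi.
by rewrite (residualE hM hA hrun hchi1 hchi) norm2Z normrN be_succ mulrC.
Qed.
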